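(* Let $S$ be an archimedean semigroup. If $S$ is finitely connected, then $S$ is finitely generated (as a semigroup).
   Context: A right congruence on a semigroup $S$ is an equivalence relation $\rho$ on $S$ such that $(a,b)\in\rho$ implies $(as,bs)\in\rho$ for all $s\in S$. The right congruence generated by a set $X\subseteq S\times S$ is the smallest right congruence on $S$ containing $X$; a right congruence is finitely generated if it is generated by some finite set $X$. A semigroup $S$ is finitely connected if the universal relation $S\times S$ is finitely generated as a right congruence on $S$. An archimedean semigroup is a commutative semigroup $S$ in which, for all $a,b\in S$, there exists $n>0$ such that $a^n\leq b$, where $x\leq y$ means $x\in yS^1$ (and $S^1$ is $S$ with an identity adjoined if necessary). *)

(* Defs.v *)
From HB Require Import structures.
From Corelib Require Import RelationClasses.
From mathcomp Require Import all_boot.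
From mathcomp Require Import classical_sets cardinality.

Set Implicit Arguments.
Unset Strict Implicit.
Unset Printing Implicit Defensive.

Local Open Scope group_scope.
Local Open Scope classical_set_scope.

Section Semigroups.
Variable S : semigroupType.
Implicit Types (rho X : set (S * S)) (A B : set S) (a b x y : S).

Definition right_congruence rho : Prop :=
  Equivalence (fun a b => rho (a, b)) /\
  (forall a b, rho (a, b) -> forall s : S, rho (a * s, b * s)).

Definition right_congruence_generated X : set (S * S) :=
  smallest right_congruence X.

Definition finitely_generated_right_congruence rho : Prop :=
  exists2 X, finite_set X & right_congruence_generated X = rho.

(* As S need not have an identity, the power a ^ n is only meaningful for
   0 < n; the value at n = 0 is the junk value a. *)
Definition sgexp a (n : nat) : S := iterop n *%g a a.

(* y S^1 *)
Definition principal_right_ideal y : set S := [set y] `|` range (fun s => y * s).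

Definition sgle x y : Prop := principal_right_ideal y x.

Definition subsemigroup B : Prop := forall x y, B x -> B y -> B (x * y).

Definition subsemigroup_generated A : set S := smallest subsemigroup A.

End Semigroups.

Definition finitely_connected (S : semigroupType) : Prop :=
  finitely_generated_right_congruence [set: S * S].

Definition finitely_generated (S : semigroupType) : Prop :=
  exists2 A : set S, finite_set A & subsemigroup_generated A = [set: S].

Definition archimedean (S : semigroupType) : Prop :=
  commutative (@mul S) /\
  (forall a b : S, exists2 n : nat, (0 < n)%N & sgle (sgexp a n) b).

(* Main.v *)
Require Import Defs.
From mathcomp Require Import all_boot.
From mathcomp Require Import boolp classical_sets cardinality.

(** Let [X] be a finite set of pairs generating [S * S], and let [Y] consist of
    the coordinates of these pairs and one more element.

    The pairs lying in the right ideal [Y S^1], together with the diagonal, form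
    a right congruence containing [X], so [S = Y S^1].  Unfolding this equality,
    an element [x] outside the subsemigroup [<Y>] is divisible by words over [Y]
    of every length.  As [Y] is finite, a long word repeats some letter many
    times, and for each [b] a high power of that letter is divisible by [b].
    Hence [x] is divisible by every element of [S]
    ([divisible_outside_generated]).

    If [<Y>] is not already [S], such an [x] exists; being divisible by [x^2],
    it yields an idempotent [e], and every element outside [<Y>] lies in [e S].
    The ideal [e S] is a group: [e] is divisible by every element, so each [y]
    in [Y] has a [y'] with [y y' = e].  Multiplication by [e] maps [S] onto this
    group, and carries the universal congruence to one generated by the image of
    [X], so the group is generated by [e], the [y] and the [y']
    ([idempotent_ideal_generated]).  Thus [Y], [e] and the [y'] generate [S]. *)

Set Implicit Arguments.
Unset Strict Implicit.
Unset Printing Implicit Defensive.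

Local Open Scope group_scope.
Local Open Scope classical_set_scope.

Section Generation.
Variable S : semigroupType.
Implicit Types (X : set (S * S)) (A : set S) (x y b c e t : S) (s w : seq S).

Lemma mem_generated A x : A x -> subsemigroup_generated A x.
Proof. by move=> Ax B [_ AB]; apply: AB. Qed.

Lemma mul_generated A x y : subsemigroup_generated A x ->
  subsemigroup_generated A y -> subsemigroup_generated A (x * y).
Proof. by move=> Ax Ay B BP; case: (BP) => BM _; apply: BM; [apply: Ax|apply: Ay]. Qed.

Lemma generated_mono A B : A `<=` B ->
  subsemigroup_generated A `<=` subsemigroup_generated B.
Proof. by move=> AB x Ax C [CM BC]; apply: Ax; split=> // y /AB /BC. Qed.

(** The relation equating all elements of the right ideal [Y S^1], and nothing
    else, is a right congruence containing [X].  Since [Y] is nonempty and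
    [X] generates the universal relation, everything is in that ideal. *)
Lemma right_ideal_of_generators X (Y : set S) x0 :
  right_congruence_generated X = [set: S * S] -> Y x0 ->
  (forall p, X p -> Y p.1 /\ Y p.2) ->
  forall x, exists2 y, Y y & sgle x y.
Proof.
move=> genX Yx0 XY x; pose I z := exists2 y, Y y & sgle z y.
have IY z : Y z -> I z by move=> Yz; exists z => //; left.
have IM z t : I z -> I (z * t).
  case=> y Yy zy; exists y => //; right.
  by case: zy => [->|[u _ <-]]; [exists t|exists (u * t); rewrite ?mulgA].
have : right_congruence_generated X (x0, x) by rewrite genX.
move=> /(_ [set p | p.1 = p.2 \/ (I p.1 /\ I p.2)]) /= [].
- split; last by move=> p /XY[? ?]; right; split; apply: IY.
  split; last by move=> a b /= [->|[? ?]] t; [left|right; split; apply: IM].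
  split=> [a|a b|a b c] /=; first by left.
  + by case=> [->|[]]; [left|right].
  + by case=> [->|[Ia Ib]] // [<-|[_ Ic]]; right.
- by move=> <-; apply: IY.
- by case.
Qed.

(** Peeling one letter of [s] off [x] leaves a cofactor that is again outside
    the generated subsemigroup, so the process never stops.  In the absence of
    an identity, the product of a word [w] by [t] is written [foldr mul t w],
    which makes sense for the empty word. *)
Lemma divisible_by_words s : (forall x, exists2 y, y \in s & sgle x y) ->
  forall x, ~ subsemigroup_generated [set` s] x ->
  forall k, exists w t, [/\ size w = k, {subset w <= s} & x = foldr mul t w].
Proof.
move=> divs x xNs k; elim: k x xNs => [|k IHk] x xNs; first by exists [::], x.
have [y ys [xy|[u _ xyu]]] := divs x.
  by case: xNs; apply: mem_generated; rewrite xy.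
have [|w [t [wk ws ut]]] := IHk u.
  by move=> su; apply: xNs; rewrite -xyu; apply: mul_generated => //; apply: mem_generated.
exists (y :: w), t; split=> /=; [by rewrite wk| |by rewrite -ut].
by move=> z; rewrite inE => /predU1P[->|/ws].
Qed.

Lemma pigeonhole_word n s w : {subset w <= s} -> (size s * n < size w)%N ->
  exists2 y, y \in s & (n <= count_mem y w)%N.
Proof.
elim: s w => [|y s IHs] w ws; first by case: w ws => // z w /(_ z (mem_head _ _)).
move=> lt_w; have [le_n|lt_n] := leqP n (count_mem y w).
  by exists y; rewrite ?mem_head.
have [z||z zs le_n] := IHs (filter (predC1 y) w).
- by rewrite mem_filter => /andP[/= /negPf zy /ws]; rewrite inE zy.
- rewrite size_filter -(ltn_add2l (count_mem y w)) count_predC.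
  by apply: leq_trans lt_w; rewrite ltnS /= mulSn leq_add2r ltnW.
- exists z; first by rewrite inE zs orbT.
  by apply: leq_trans le_n _; rewrite count_filter; apply: sub_count => u /= /andP[].
Qed.

Hypothesis archS : archimedean S.
Let mulC : commutative (@mul S) := proj1 archS.

Lemma foldr_mul_gather y t w : foldr mul t w =
  iter (count_mem y w) (mul y) (foldr mul t (filter (predC1 y) w)).
Proof.
have iterM n z u : iter n (mul y) (z * u) = z * iter n (mul y) u.
  by elim: n => //= n ->; rewrite !mulgA (mulC y).
elim: w => //= z w ->; case: eqP => [->|_] //=; by rewrite iterM.
Qed.

(** Each letter has its own archimedean exponent with respect to [b]; larger
    exponents also work, so the maximum serves all letters at once. *)
Lemma uniform_archimedean_exponent s b : exists n, forall m y t,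
  (n <= m)%N -> y \in s -> exists u, iter m (mul y) t = b * u.
Proof.
elim: s => [|y s [n nP]]; first by exists 0%N.
have [[//|k] _ yb] := proj2 archS y b.
exists (maxn k.+1 n) => m z t; rewrite geq_max => /andP[km nm].
rewrite inE => /predU1P[->|zs]; last exact: nP.
have iterE i u : iter i.+1 (mul y) u = sgexp y i.+1 * u.
  by rewrite /sgexp iteropS; elim: i => //= i ->; rewrite mulgA.
rewrite -(subnKC km) iterD iterE; set u := iter _ _ t.
case: yb => [->|[v _ <-]]; first by exists u.
by exists (v * u); rewrite mulgA.
Qed.

(** A long word dividing [x] repeats some letter often enough for the power of
    that letter to be a multiple of [b]. *)
Lemma divisible_outside_generated s x :
  (forall x, exists2 y, y \in s & sgle x y) ->
  ~ subsemigroup_generated [set` s] x -> forall b, exists u, x = b * u.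
Proof.
move=> divs xNs b; have [n nP] := uniform_archimedean_exponent s b.
have [w [t [wk ws ->]]] := divisible_by_words divs xNs (size s * n).+1.
have [|y ys le_n] := pigeonhole_word (n := n) ws; first by rewrite wk.
by rewrite (foldr_mul_gather y); apply: nP.
Qed.

(** All powers of [e] equal [e], so the archimedean property says that [e]
    itself is divisible by [c]. *)
Lemma idempotent_divisible e c : e * e = e -> exists c', c * c' = e.
Proof.
move=> ee; have [[//|n] _] := proj2 archS e c.
rewrite /sgexp iteropS; have -> : iter n (mul e) e = e by elim: n => //= n ->.
by case=> [<-|[c' _ <-]]; [exists e|exists c'].
Qed.

(** Relate [a] and [b] when each of [e a], [e b] is a multiple of the other by
    an element of the subsemigroup [<A>]; this is a right congruence.  Given local inverses in [A],
    a pair [(c, d)] of [X] is so related, through [c' d] and [d' c]; hence all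
    elements are, and [e a] is obtained from [e] by a factor in [<A>]. *)
Lemma idempotent_ideal_generated X A e :
  right_congruence_generated X = [set: S * S] -> e * e = e -> A e ->
  (forall p, X p -> A p.1 /\ A p.2) ->
  (forall p, X p -> (exists2 c', A c' & p.1 * c' = e) /\
                    (exists2 d', A d' & p.2 * d' = e)) ->
  forall a, subsemigroup_generated A (e * a).
Proof.
move=> genX ee Ae XA Xinv a; set T := subsemigroup_generated A.
pose R x y := exists2 p, T p & e * x * p = e * y.
have Te : T e by apply: mem_generated.
have R_trans x y z : R x y -> R y z -> R x z.
  move=> [p Tp pE] [q Tq qE]; exists (p * q); first exact: mul_generated.
  by rewrite mulgA pE qE.
have RM x y t : R x y -> R (x * t) (y * t).
  move=> [p Tp pE]; exists p => //.
  by rewrite !mulgA -pE -!mulgA (mulC t).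
have R_inv c c' d : A c' -> A d -> c * c' = e -> R c d.
  move=> Ac' Ad cc'; exists (c' * d); first by apply: mul_generated; apply: mem_generated.
  by rewrite !mulgA -(mulgA e c) cc' ee.
have : right_congruence_generated X (e, a) by rewrite genX.
move=> /(_ [set p | R p.1 p.2 /\ R p.2 p.1]) /= [].
- split; last first.
    move=> [c d] Xcd; have [/= Ac Ad] := XA _ Xcd.
    have [[/= c' Ac' cc'] [d' Ad' dd']] := Xinv _ Xcd.
    by split; [apply: (R_inv _ c')|apply: (R_inv _ d')].
  split; last by move=> x y [xy yx] t; split; apply: RM.
  split=> [x|x y|x y z] /=.
  + by split; exists e => //; rewrite mulC mulgA ee.
  + by case.
  + by case=> xy yx [yz zy]; split; apply: R_trans; eassumption.
- by move=> [p Tp <-] _; rewrite ee; apply: mul_generated.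
Qed.

End Generation.

Theorem proposition6p6 (S : semigroupType) :
  archimedean S -> finitely_connected S -> finitely_generated S.
Proof.
move=> archS [X finX genX].
have [[x0 _]|S0] := pselect (exists x : S, True); last first.
  by exists set0 => //; apply/seteqP; split=> // x; case: S0; exists x.
have [xs Xxs] := (finite_seqP X).1 finX.
pose s := x0 :: map fst xs ++ map snd xs.
have Xs p : X p -> p.1 \in s /\ p.2 \in s.
  by rewrite Xxs /= !inE !mem_cat => pxs; rewrite !(map_f _ pxs) !orbT.
have divs := right_ideal_of_generators genX (mem_head x0 _ : [set` s] x0) Xs.
have [genS|/existsNP[x xNs]] := pselect (forall x, subsemigroup_generated [set` s] x).
  by exists [set` s]; [exact: finite_seq|apply/seteqP; split].
have {x xNs}[e ee] : exists e : S, e * e = e.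
  (* [x] is divisible by its square: if [x = x x u], then [x u] is idempotent. *)
  have [u xxu] := divisible_outside_generated archS divs xNs (x * x).
  by exists (x * u); rewrite -mulgA (proj1 archS u) !mulgA -xxu.
have /choice[inv invP] : forall c : S, exists c', c * c' = e.
  by move=> c; apply: idempotent_divisible.
pose s' := e :: s ++ map inv s.
have sub_s y : y \in s -> y \in s'.
  by move=> ys; rewrite in_cons (mem_cat _ s) ys orbT.
have inv_s y : y \in s -> inv y \in s'.
  by move=> ys; rewrite in_cons (mem_cat _ s) map_f ?orbT.
exists [set` s']; first exact: finite_seq.
apply/seteqP; split=> // x _.
have [xgen|xNs] := pselect (subsemigroup_generated [set` s] x).
  by apply: generated_mono xgen => y; apply: sub_s.
have [u ->] := divisible_outside_generated archS divs xNs e.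
apply: (idempotent_ideal_generated archS genX ee) => [|p /Xs[? ?]|p /Xs[p1 p2]].
- exact: mem_head.
- by split; apply: sub_s.
- by split; [exists (inv p.1)|exists (inv p.2)] => //; apply: inv_s.
Qed.
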